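(* There do not exist a real number $z_0>0$, an integer $r\in\mathbb{N}=\{0,1,2,\dots\}$ and a continuous map $H:[0,z_0]\to\mathcal{M}_r(\mathbb{R})$ such that for all $z\in[0,z_0]$ the matrix $H(z)$ is symmetric and has the following property: for every real sequence $\boldsymbol{\Phi}=(\Phi_j)_{j\le 2}\in\ell^2(-\infty,2)$ satisfying the first order extrapolation boundary condition $\Phi_2=\Phi_1=\Phi_0$, the energy inequality $$\sum_{j\le -r}\Psi_j^2+\begin{pmatrix}\Psi_{-r+1}\\ \vdots\\ \Psi_0\end{pmatrix}^T H(z)\begin{pmatrix}\Psi_{-r+1}\\ \vdots\\ \Psi_0\end{pmatrix}-\sum_{j\le -r}\Phi_j^2-\begin{pmatrix}\Phi_{-r+1}\\ \vdots\\ \Phi_0\end{pmatrix}^T H(z)\begin{pmatrix}\Phi_{-r+1}\\ \vdots\\ \Phi_0\end{pmatrix}\le 0$$ holds, where the sequence $\boldsymbol{\Psi}=(\Psi_j)_{j\le 0}$ is defined by $$\forall\, j\le 0,\quad \Psi_j:=\Phi_j-z\,D_0\Phi_j+\frac{z^2}{2}\,\Delta\Phi_j+\frac{z(1-z^2)}{6}\,D_0\Delta\Phi_j-\frac{z^2(1-z^2)}{24}\,\Delta^2\Phi_j .$$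
   Context: $\ell^2(-\infty,2)$ denotes the space of real square-summable sequences indexed by the integers $j\le 2$. $\mathcal{M}_r(\mathbb{R})$ is the space of real $r\times r$ matrices; when $r=0$ the quadratic terms involving $H(z)$ are absent. The difference operators are $$D_0\Phi_j:=\tfrac12(\Phi_{j+1}-\Phi_{j-1}),\qquad \Delta\Phi_j:=\Phi_{j-1}-2\Phi_j+\Phi_{j+1},$$ $$D_0\Delta\Phi_j=\tfrac12(-\Phi_{j-2}+2\Phi_{j-1}-2\Phi_{j+1}+\Phi_{j+2}),\qquad \Delta^2\Phi_j=\Phi_{j-2}-4\Phi_{j-1}+6\Phi_j-4\Phi_{j+1}+\Phi_{j+2}.$$ No positivity of $H(z)$ is assumed. *)

(* Defs.v *)
From mathcomp Require Import all_boot all_order all_algebra.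
From mathcomp Require Import all_classical all_reals all_analysis.
From mathcomp Require Import ring.
Set Implicit Arguments.
Unset Strict Implicit.
Unset Printing Implicit Defensive.
Import Order.TTheory GRing.Theory Num.Theory.
Import numFieldNormedType.Exports.
Local Open Scope classical_set_scope.
Local Open Scope ring_scope.

(* Sequences indexed by the integers j <= n are represented by functions on
   all of int, of which only the values at indices <= n are ever used. *)

Section Scheme.
Variable R : realType.
Implicit Types (U Phi : int -> R) (j n : int) (z : R).

Definition D0 U j : R := (U (j + 1) - U (j - 1)) / 2.

Definition Delta U j : R := U (j - 1) - 2 * U j + U (j + 1).

(* D_0 Delta and Delta^2 are compositions; they only involve the values of
   the sequence at j-2, ..., j+2. *)
Lemma D0_DeltaE U j : D0 (Delta U) j =
  (- U (j - 2) + 2 * U (j - 1) - 2 * U (j + 1) + U (j + 2)) / 2.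
Proof.
rewrite /D0 /Delta.
have -> : j + 1 - 1 = j by ring.
have -> : j - 1 + 1 = j by ring.
have -> : j + 1 + 1 = j + 2 by ring.
have -> : j - 1 - 1 = j - 2 by ring.
by congr (_ / _); ring.
Qed.

Lemma Delta_DeltaE U j : Delta (Delta U) j =
  U (j - 2) - 4 * U (j - 1) + 6 * U j - 4 * U (j + 1) + U (j + 2).
Proof.
rewrite /Delta.
have -> : j + 1 - 1 = j by ring.
have -> : j - 1 + 1 = j by ring.
have -> : j + 1 + 1 = j + 2 by ring.
have -> : j - 1 - 1 = j - 2 by ring.
by ring.
Qed.

(* Psi_j; for j <= 0 it depends on Phi_k for k <= 2 only. *)
Definition scheme z Phi j : R :=
  Phi j - z * D0 Phi j + z ^+ 2 / 2 * Delta Phi j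
  + z * (1 - z ^+ 2) / 6 * D0 (Delta Phi) j
  - z ^+ 2 * (1 - z ^+ 2) / 24 * Delta (Delta Phi) j.

(* The sum of the U_j^2 over j <= n, possibly +oo. *)
Definition sqsum n U : \bar R := \esum_(j in [set j | j <= n]) (U j ^+ 2)%:E.

Definition ell2 n U : Prop := (sqsum n U < +oo)%E.

(* The column (U_{-r+1}, ..., U_0). *)
Definition boundary_vec (r : nat) U : 'cV[R]_r :=
  \col_(i < r) U (- r%:Z + 1 + i%:Z).

(* For r = 0 the product is a sum over an empty index set, hence 0. *)
Definition quad (r : nat) (M : 'M[R]_r) (v : 'cV[R]_r) : R :=
  (v^T *m M *m v) 0 0.

End Scheme.

(* Main.v *)
Require Import Defs.
From mathcomp Require Import all_boot all_order all_algebra.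
From mathcomp Require Import all_classical all_reals all_analysis.
From mathcomp Require Import ring lra zify.
Import Order.TTheory GRing.Theory Num.Theory.
Import numFieldNormedType.Exports.
Local Open Scope classical_set_scope.
Local Open Scope ring_scope.

(** Only the limit z -> 0 matters. There the scheme is Phi + z L Phi + O(z^2),
with L the five-point skew-symmetric approximation of - d/dx, so dividing the
energy inequality by z gives
  <Phi, L Phi>_{H(0)} <= 0
for the bilinear form attached to H(0) ([dissipation_le0]). Finitely supported
sequences are enough, and for them every energy is a finite sum. Since L is
skew-symmetric in the interior, the sum of Phi_j (L Phi)_j over j <= -r
telescopes to a [flux] at -r, and the left-hand side becomes a quadratic form
[dissipation] in finitely many values of Phi near the boundary.

The outermost value that occurs, Phi_{-r-1}, occurs linearly only: it enters
the flux, and (L Phi)_{-r+1} because L reaches two cells away. A function that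
is affine in this value and never positive cannot depend on it
([affine_le0_slope]), and this says that the first column of H(0) is the first
unit vector ([first_column]). As H(0) is symmetric, its first row and column
then only contribute the term of index -r+1 that the interior sum would
contain for a matrix of size r-1 ([dissipation_peel]). Iterating removes H(0)
altogether. What is left is the flux at 0, which under the extrapolation
Phi_2 = Phi_1 = Phi_0 equals (Phi_{-1} Phi_0 - 7 Phi_0^2) / 12. It is linear in
Phi_{-1} and takes positive values ([dissipation_positive]). *)

Section NoLocalEnergy.
Set Implicit Arguments.
Unset Strict Implicit.
Variable R : realType.
Implicit Types (U V W Phi : int -> R) (z t : R) (n j k : int).

(** * Finitely supported sequences *)

Definition vanishes_below N U := forall j, j < - N%:Z -> U j = 0.

Definition admissible Phi :=
  [/\ Phi 2 = Phi 1, Phi 1 = Phi 0 & exists N : nat, vanishes_below N Phi].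

Lemma sqsum_peel n U : sqsum n U = ((U n ^+ 2)%:E + sqsum (n - 1) U)%E.
Proof.
rewrite /sqsum (esumID [set n]); last by move=> i _; rewrite lee_fin sqr_ge0.
congr (_ + _)%E.
  rewrite (_ : _ `&` _ = [set n]); first by rewrite esum_set1 // lee_fin sqr_ge0.
  by apply/seteqP; split => j /= => [[]//|->]; split.
congr (\esum_(j in _) _); apply/seteqP; split => j /=.
  by move=> [jn /eqP njn]; lia.
by move=> jn; split; [lia|move=> jn'; lia].
Qed.

Lemma sqsum_finite (K : nat) n U : (forall j, j <= n - K%:Z -> U j = 0) ->
  sqsum n U = (\sum_(k < K) U (n - k%:Z) * U (n - k%:Z))%:E.
Proof.
elim: K n => [|K IH] n U0.
  rewrite big_ord0 /sqsum esum1 // => j /= jn.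
  by rewrite U0 ?expr0n //; lia.
rewrite sqsum_peel IH; last by move=> j jn; apply: U0; lia.
rewrite big_ord_recl subr0 -EFinD expr2; congr (_ + _)%:E.
apply: eq_bigr => i _; rewrite lift0.
by have -> : n - 1 - i%:Z = n - i.+1%:Z by lia.
Qed.

(** * Energies as bilinear forms *)

Definition bilin {r : nat} (M : 'M[R]_r) (u v : 'cV[R]_r) : R :=
  (u^T *m M *m v) 0 0.

Definition energy {r : nat} (M : 'M[R]_r) (K : nat) U V : R :=
  \sum_(k < K) U (- r%:Z - k%:Z) * V (- r%:Z - k%:Z)
  + bilin M (boundary_vec r U) (boundary_vec r V).

Lemma bilinE r (M : 'M[R]_r) u v :
  bilin M u v = \sum_i \sum_j u i 0 * M i j * v j 0.
Proof.
rewrite /bilin mxE exchange_big; apply: eq_bigr => j _.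
rewrite mxE mulr_suml; apply: eq_bigr => i _.
by rewrite mxE.
Qed.

Lemma bilinDZr r (M : 'M[R]_r) u v w t :
  bilin M u (v + t *: w) = bilin M u v + t * bilin M u w.
Proof. by rewrite /bilin mulmxDr -scalemxAr !mxE. Qed.

Lemma bilinDZl r (M : 'M[R]_r) u v w t :
  bilin M (u + t *: w) v = bilin M u v + t * bilin M w v.
Proof. by rewrite /bilin linearD linearZ /= !mulmxDl -!scalemxAl !mxE. Qed.

Lemma bilinC r (M : 'M[R]_r) u v : M^T = M -> bilin M u v = bilin M v u.
Proof.
move=> Msym.
by rewrite /bilin -[v^T *m M *m u]trmxK [RHS]mxE !trmx_mul trmxK Msym mulmxA.
Qed.

Lemma boundary_vecDZ r U V t :
  boundary_vec r (fun j => U j + t * V j)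
  = boundary_vec r U + t *: boundary_vec r V.
Proof. by apply/matrixP => i j; rewrite !mxE. Qed.

(** The factor t is what remains to be divided out before the time step tends
to 0. *)
Lemma energy_increment r (M : 'M[R]_r) K U V t : M^T = M ->
  energy M K (fun j => U j + t * V j) (fun j => U j + t * V j) - energy M K U U
  = t * (2 * energy M K U V + t * energy M K V V).
Proof.
move=> Msym; rewrite /energy boundary_vecDZ bilinDZr !bilinDZl.
rewrite (bilinC (boundary_vec r V)) //.
set b1 := bilin _ _ _; set b2 := bilin _ _ _; set b3 := bilin _ _ _.
have -> : \sum_(k < K) (U (- r%:Z - k%:Z) + t * V (- r%:Z - k%:Z)) *
                       (U (- r%:Z - k%:Z) + t * V (- r%:Z - k%:Z)) =
  \sum_(k < K) U (- r%:Z - k%:Z) * U (- r%:Z - k%:Z)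
  + 2 * t * (\sum_(k < K) U (- r%:Z - k%:Z) * V (- r%:Z - k%:Z))
  + t * t * (\sum_(k < K) V (- r%:Z - k%:Z) * V (- r%:Z - k%:Z)).
  by rewrite !mulr_sumr -!big_split /=; apply: eq_bigr => i _; ring.
by ring.
Qed.

(** * The limit of vanishing time step *)

Definition advection Phi j : R := - D0 Phi j + D0 (Delta Phi) j / 6.

(** The difference quotient (scheme z Phi - Phi) / z, extended to z = 0. *)
Definition increment z Phi j : R :=
  - D0 Phi j + z / 2 * Delta Phi j + (1 - z ^+ 2) / 6 * D0 (Delta Phi) j
  - z * (1 - z ^+ 2) / 24 * Delta (Delta Phi) j.

Lemma schemeE z Phi : scheme z Phi = fun j => Phi j + z * increment z Phi j.
Proof. by apply/funext => j; rewrite /scheme /increment; ring. Qed.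

Lemma increment0 Phi : increment 0 Phi = advection Phi.
Proof. by apply/funext => j; rewrite /increment /advection; field. Qed.

(** The centred fourth-order difference approximating - d/dx. *)
Lemma advectionE Phi j : advection Phi j =
  (- 8 * (Phi (j + 1) - Phi (j - 1)) + (Phi (j + 2) - Phi (j - 2))) / 12.
Proof. by rewrite /advection D0_DeltaE /D0; field. Qed.

Lemma vanishes_increment N z Phi :
  vanishes_below N Phi -> vanishes_below N.+2 (increment z Phi).
Proof.
move=> P0 j jN; rewrite /increment Delta_DeltaE D0_DeltaE /D0 /Delta.
by rewrite !P0; [ring|lia..].
Qed.

Lemma cvg_increment Phi j :
  increment z Phi j @[z --> 0^'+] --> advection Phi j.
Proof.
rewrite -increment0 /increment; apply: cvg_at_right_filter.
rewrite /continuous_at.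
apply: cvgB; [apply: cvgD; [apply: cvgD|]|].
- exact: cvg_cst.
- apply: cvgM; last exact: cvg_cst.
  by apply: cvgM; [exact: cvg_id|exact: cvg_cst].
- apply: cvgM; last exact: cvg_cst.
  apply: cvgM; last exact: cvg_cst.
  by apply: cvgB; [exact: cvg_cst|exact: exprn_continuous].
- apply: cvgM; last exact: cvg_cst.
  apply: cvgM; last exact: cvg_cst.
  apply: cvgM; first exact: cvg_id.
  by apply: cvgB; [exact: cvg_cst|exact: exprn_continuous].
Qed.

Lemma cvg_energy r (M : R -> 'M[R]_r) (M0 : 'M[R]_r) K
    (U V : R -> int -> R) (U0 V0 : int -> R) (F : set_system R) :
  Filter F ->
  (forall i (j : 'I_r), M z i j @[z --> F] --> M0 i j) ->
  (forall j, U z j @[z --> F] --> U0 j) ->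
  (forall j, V z j @[z --> F] --> V0 j) ->
  energy (M z) K (U z) (V z) @[z --> F] --> energy M0 K U0 V0.
Proof.
move=> FF cM cU cV; rewrite /energy.
under eq_fun do rewrite bilinE.
rewrite bilinE; apply: cvgD.
  by apply: cvg_big => [|k _]; [exact: add_continuous|exact: cvgM].
apply: cvg_big => [|i _]; first exact: add_continuous.
apply: cvg_big => [|j _]; first exact: add_continuous.
have cvec (W : R -> int -> R) W0 (k : 'I_r) :
    (forall l, W z l @[z --> F] --> W0 l) ->
    boundary_vec r (W z) k 0 @[z --> F] --> boundary_vec r W0 k 0.
  by move=> cW; rewrite mxE; under eq_fun do rewrite mxE; exact: cW.
by apply: cvgM; [apply: cvgM; [exact: cvec|exact: cM]|exact: cvec].
Qed.

(** The discrete primitive of Phi * advection Phi: see [advection_flux]. *)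
Definition flux n Phi : R :=
  - (2 / 3) * (Phi n * Phi (n + 1))
  + (Phi n * Phi (n + 2) + Phi (n - 1) * Phi (n + 1)) / 12.

Lemma advection_flux n Phi :
  Phi n * advection Phi n = flux n Phi - flux (n - 1) Phi.
Proof.
rewrite advectionE /flux.
have -> : n - 1 + 1 = n by ring.
have -> : n - 1 + 2 = n + 1 by ring.
have -> : n - 1 - 1 = n - 2 by ring.
by field.
Qed.

Lemma sum_advection_flux (K : nat) n Phi :
  \sum_(k < K) Phi (n - k%:Z) * advection Phi (n - k%:Z)
  = flux n Phi - flux (n - K%:Z) Phi.
Proof.
elim: K => [|K IH]; first by rewrite big_ord0 !subr0 subrr.
rewrite big_ord_recr /= IH advection_flux.
have -> : n - K%:Z - 1 = n - K.+1%:Z by lia.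
by ring.
Qed.

(** The bilinear form of the energy with matrix M at (Phi, advection Phi),
after the interior sum has been telescoped. *)
Definition dissipation {r : nat} (M : 'M[R]_r) Phi : R :=
  flux (- r%:Z) Phi
  + bilin M (boundary_vec r Phi) (boundary_vec r (advection Phi)).

(** The energy inequality divided by z, in the limit z -> 0: the quadratic
part of the increment carries a factor z and disappears. *)
Lemma dissipation_le0 (z0 : R) (r : nat) (H : R -> 'M[R]_r) :
  0 < z0 -> {within `[0, z0], continuous H} ->
  (forall z : R, 0 <= z <= z0 ->
     (H z)^T = H z /\
     forall Phi : int -> R,
       ell2 2 Phi -> Phi 2 = Phi 1 -> Phi 1 = Phi 0 ->
       let Psi := scheme z Phi in
       (sqsum (- r%:Z) Psi + (quad (H z) (boundary_vec r Psi))%:E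
        - sqsum (- r%:Z) Phi - (quad (H z) (boundary_vec r Phi))%:E <= 0)%E) ->
  forall Phi, admissible Phi -> dissipation (H 0) Phi <= 0.
Proof.
move=> z0_gt0 cH decay Phi [P21 P10 [N P0]].
have l2 : ell2 2 Phi.
  by rewrite /ell2 (@sqsum_finite N.+3) ?ltry // => j jN; apply: P0; lia.
(* The increment reaches two cells beyond the support of Phi, down to the index
   -N-2; starting at -r, K terms go down to -r-N-2, whatever r is. *)
pose K := N.+3.
pose F z := 2 * energy (H z) K Phi (increment z Phi)
  + z * energy (H z) K (increment z Phi) (increment z Phi).
have F_le0 z : 0 < z <= z0 -> F z <= 0.
  move=> /andP[z_gt0 zz0].
  have [|Hsym /(_ Phi l2 P21 P10)] := decay z; first by rewrite (ltW z_gt0).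
  have vI := @vanishes_increment N z Phi P0.
  rewrite schemeE /=.
  rewrite (sqsum_finite (K := K)) => [|j jN]; last first.
    by rewrite P0 ?vI ?mulr0 ?addr0 //; rewrite /K in jN; lia.
  rewrite (sqsum_finite (K := K)) => [|j jN]; last first.
    by rewrite P0 //; rewrite /K in jN; lia.
  rewrite -!EFinN -!EFinD lee_fin -(@pmulr_rle0 _ z (F z)) //.
  by rewrite /F -energy_increment // /energy opprD addrA.
have cvF : F z @[z --> 0^'+] --> 2 * energy (H 0) K Phi (advection Phi).
  have cHij (i j : 'I_r) : H z i j @[z --> 0^'+] --> H 0 i j.
    have : {within `[0, z0], continuous (fun z => H z i j)}.
      move=> x.
      exact: (@continuous_comp (subspace `[0, z0]) _ _ H
        (fun M : 'M[R]_r => M i j) x (cH x) (@coord_continuous _ _ _ i j _)).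
    by move/continuous_within_itvP => /(_ z0_gt0)[].
  rewrite -[X in _ --> X]addr0 -[X in _ --> _ + X](mul0r
    (energy (H 0) K (advection Phi) (advection Phi))).
  apply: cvgD; apply: cvgM.
  - exact: cvg_cst.
  - apply: cvg_energy => // j; [exact: cvg_cst|exact: cvg_increment].
  - by apply: cvg_at_right_filter; exact: cvg_id.
  - by apply: cvg_energy => // j; exact: cvg_increment.
have : 2 * energy (H 0) K Phi (advection Phi) <= 0.
  apply: (cvgr_to_le cvF); near=> z; apply: F_le0; apply/andP; split.
    by near: z; exact: nbhs_right_gt.
  by near: z; exact: nbhs_right_le.
rewrite pmulr_rle0 // /energy sum_advection_flux /dissipation.
suff -> : flux (- r%:Z - K%:Z) Phi = 0 by rewrite subr0.
by rewrite /flux /K !P0; [ring|lia..].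
Unshelve. all: by end_near.
Qed.

(** * Peeling the matrix *)

Lemma affine_le0_slope (a b : R) : (forall t, a + t * b <= 0) -> b = 0.
Proof.
move=> ab; apply/eqP/negPn/negP => b0.
by have := ab ((1 - a) / b); rewrite divfK // addrC subrK ler10.
Qed.

(** For a matrix of size r+1 the interior ends at -r-1, and the value of index
-r-2 acts on the flux through its neighbour at -r, and on the boundary terms
through the first component of the advection. No square of the perturbation
appears. *)
Lemma dissipation_perturb r (M : 'M[R]_r.+1) Phi t :
  dissipation M (fun j => Phi j + t * (j == - r%:Z - 2)%:R)
  = dissipation M Phi + t * ((Phi (- r%:Z) -
      \sum_(i < r.+1) Phi (- r%:Z + i%:Z) * M i 0) / 12).
Proof.
rewrite /dissipation.
pose d j : R := (j == - r%:Z - 2)%:R.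
have -> : boundary_vec r.+1 (fun j => Phi j + t * d j) = boundary_vec r.+1 Phi.
  apply/matrixP => i j; rewrite !mxE /d.
  by rewrite (_ : (_ == _) = false) ?mulr0 ?addr0 //; lia.
have -> : boundary_vec r.+1 (advection (fun j => Phi j + t * d j))
  = boundary_vec r.+1 (advection Phi) + (- (t / 12)) *: delta_mx 0 0.
  apply/matrixP => i j; rewrite !mxE !advectionE /d ord1 andbT.
  set m : int := - r.+1%:Z + 1 + i%:Z.
  rewrite (_ : (m + 1 == _) = false); last by rewrite /m; lia.
  rewrite (_ : (m - 1 == _) = false); last by rewrite /m; lia.
  rewrite (_ : (m + 2 == _) = false); last by rewrite /m; lia.
  rewrite (_ : (m - 2 == _) = (i == 0)); last by rewrite -val_eqE /= /m; lia.
  by rewrite !mulr0n; case: (i == 0) => /=; field.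
rewrite bilinDZr.
have -> : bilin M (boundary_vec r.+1 Phi) (delta_mx 0 0)
  = \sum_(i < r.+1) Phi (- r%:Z + i%:Z) * M i 0.
  rewrite bilinE; apply: eq_bigr => i _.
  rewrite (bigD1 0) //= big1 ?addr0 => [|j j0].
    rewrite !mxE eqxx mulr1; congr (Phi _ * _); lia.
  by rewrite !mxE (negPf j0) mulr0.
rewrite /flux /d.
rewrite (_ : (- r.+1%:Z == _) = false); last by lia.
rewrite (_ : (- r.+1%:Z + 1 == _) = false); last by lia.
rewrite (_ : (- r.+1%:Z + 2 == _) = false); last by lia.
rewrite (_ : (- r.+1%:Z - 1 == _) = true); last by lia.
have -> : - r.+1%:Z + 1 = - r%:Z by lia.
rewrite !mulr0n mulr1n; by field.
Qed.

(** [dissipation_perturb] makes Phi_{-r} equal to the pairing of the boundary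
values with the first column. Testing with a unit vector gives each entry. *)
Lemma first_column r (M : 'M[R]_r.+1) :
  (forall Phi, admissible Phi -> dissipation M Phi <= 0) ->
  forall i, M i 0 = (i == 0)%:R.
Proof.
move=> dM i.
(* The unit vector at -r + i, extended by its value at 0 so that the
   boundary condition holds when i = r. *)
pose Phi j : R := (Num.min j 0 == - r%:Z + i%:Z)%:R.
have adm t : admissible (fun j => Phi j + t * (j == - r%:Z - 2)%:R).
  have d0 j : 0 <= j -> (j == - r%:Z - 2) = false by lia.
  split; [by rewrite !d0|by rewrite !d0|].
  exists r.+2 => j jr; rewrite /Phi.
  rewrite (_ : (_ == - r%:Z + _) = false); last by lia.
  by rewrite (_ : (_ == - r%:Z - 2) = false) ?mulr0 ?addr0 //; lia.
have /affine_le0_slope : forall t, dissipation M Phi + t * ((Phi (- r%:Z) -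
      \sum_(i < r.+1) Phi (- r%:Z + i%:Z) * M i 0) / 12) <= 0.
  by move=> t; rewrite -dissipation_perturb; exact: dM.
have -> : \sum_(k < r.+1) Phi (- r%:Z + k%:Z) * M k 0 = M i 0.
  rewrite (bigD1 i) //= big1 ?addr0 => [|k ki].
    by rewrite /Phi (_ : (_ == _) = true) ?mul1r //; have := ltn_ord i; lia.
  rewrite /Phi (_ : (_ == _) = false) ?mul0r //.
  by move: ki; have := ltn_ord k; rewrite -val_eqE /=; lia.
have -> : Phi (- r%:Z) = (i == 0)%:R.
  by rewrite /Phi; congr (_%:R); rewrite -val_eqE /=; lia.
lra.
Qed.

(** The entry 1 in the corner adds the term Phi_{-r} (advection Phi)_{-r},
which moves the flux one cell to the right. *)
Lemma dissipation_peel r (M : 'M[R]_r.+1) Phi : M^T = M ->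
  (forall i, M i 0 = (i == 0)%:R) ->
  dissipation M Phi = dissipation (row' 0 (col' 0 M)) Phi.
Proof.
move=> Msym M0.
have M0' i : M 0 i = (i == 0)%:R by rewrite -Msym mxE.
rewrite /dissipation !bilinE.
rewrite big_ord_recl big_ord_recl M0 big1 => [|j _]; last first.
  by rewrite M0' mulr0 mul0r.
rewrite (eq_bigr (fun i : 'I_r => \sum_j boundary_vec r Phi i 0
   * (row' 0 (col' 0 M)) i j * boundary_vec r (advection Phi) j 0)); last first.
  move=> i _; rewrite big_ord_recl M0 mulr0 mul0r add0r.
  apply: eq_bigr => j _; rewrite !mxE.
  have e (l : 'I_r) : - r.+1%:Z + 1 + (lift ord0 l)%:Z = - r%:Z + 1 + l%:Z.
    by rewrite lift0; lia.
  by rewrite !e.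
rewrite eqxx mulr1 addr0 addrA; congr (_ + _).
rewrite !mxE addr0.
have -> : - r.+1%:Z + 1 = - r%:Z by lia.
rewrite advection_flux.
have -> : - r%:Z - 1 = - r.+1%:Z by lia.
by ring.
Qed.

Lemma dissipation_positive r (M : 'M[R]_r) : M^T = M ->
  exists2 Phi, admissible Phi & 0 < dissipation M Phi.
Proof.
elim: r M => [|r IH] M Msym.
  (* The form is (Phi_{-1} Phi_0 - 7 Phi_0^2) / 12 here; Phi_{-1} = 8 and
     Phi_0 = 1 make it 1/12. *)
  pose Phi j : R := if 0 <= j then 1 else if j == -1 then 8 else 0.
  exists Phi; first by split => //; exists 1%N => j j1; rewrite /Phi !ifF //; lia.
  rewrite /dissipation bilinE big_ord0 addr0 oppr0 /flux /Phi /=; lra.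
have [//|noPhi] := pselect (exists2 Phi, admissible Phi & 0 < dissipation M Phi).
have dM Phi : admissible Phi -> dissipation M Phi <= 0.
  by move=> aPhi; rewrite leNgt; apply/negP => dPhi; apply: noPhi; exists Phi.
have M0 := first_column dM.
have [|Phi aPhi dPhi] := IH (row' 0 (col' 0 M)).
  by apply/matrixP => i j; rewrite !mxE -[in LHS]Msym mxE.
by exists Phi => //; rewrite dissipation_peel.
Qed.

End NoLocalEnergy.

Theorem theorem1 (R : realType) :
  ~ exists (z0 : R) (r : nat) (H : R -> 'M[R]_r),
    [/\ 0 < z0,
        {within `[0, z0], continuous H} &
        forall z : R, 0 <= z <= z0 ->
          (H z)^T = H z /\
          forall Phi : int -> R,
            ell2 2 Phi -> Phi 2 = Phi 1 -> Phi 1 = Phi 0 ->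
            let Psi := scheme z Phi in
            (sqsum (- r%:Z) Psi + (quad (H z) (boundary_vec r Psi))%:E
             - sqsum (- r%:Z) Phi - (quad (H z) (boundary_vec r Phi))%:E
             <= 0)%E].
Proof.
move=> [z0 [r [H [z0_gt0 cH decay]]]].
have [|Hsym _] := decay 0; first by rewrite lexx ltW.
have [Phi aPhi] := @dissipation_positive R r (H 0) Hsym.
by rewrite ltNge (@dissipation_le0 R z0 r H).
Qed.
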